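(* The following hold. 1. $\mathcal{T}_0 = \{x \in \mathcal{P} \mid x \in L(x^{\sqrt{2q}})\}$, that is, $\mathcal{T}_0$ is the set of absolute points of the polarity $\pi_0$. 2. $\mathcal{T}_1 = \{x \in \mathcal{P} \mid x \in L(x^{q^2\sqrt{2q}})\}$, that is, $\mathcal{T}_1$ is the set of absolute points of the polarity $\pi_1$. In particular, each $\mathcal{T}_i$ is a Suzuki–Tits ovoid: a set of $q^2+1$ points of $\mathcal{P}$ meeting every line of the cyclic presentation of $PG(3,q)$ in at most two points.
   Context: Let $q = 2^m$ with $m \ge 3$ odd, so that $\sqrt{2q} = 2^{(m+1)/2}$ is an integer. Let $E = \mathbb{F}_{q^4} \supset K = \mathbb{F}_{q^2}$, and define $\mathcal{P} = \{x \in E \mid x^{q^3+q^2+q+1} = 1\}$ and $S = \{x \in K \mid x^{q+1} = 1\}$. Put $s = q - \sqrt{2q} + 1$ and $t = q + \sqrt{2q} + 1$, and let $\mathcal{O}_s = \{x \in E \mid x^s = 1\}$ and $\mathcal{O}_t = \{x \in E \mid x^t = 1\}$. Define $$\mathcal{T}_0 = \mathcal{O}_s \cup \left\{\left(v^{q-1} + v^{-(q-1)}\right)^{q-1} uv \;\middle|\; u \in \mathcal{O}_s,\ v \in \mathcal{O}_t \setminus \{1\}\right\},$$ $$\mathcal{T}_1 = \mathcal{O}_t \cup \left\{\left(u^{q-1} + u^{-(q-1)}\right)^{q-1} uv \;\middle|\; u \in \mathcal{O}_s \setminus \{1\},\ v \in \mathcal{O}_t\right\}.$$ Cyclic presentation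 of $PG(3,q)$: the point set is $\mathcal{P}$. The lines are the zero sets in $\mathcal{P}$ of $X^{q+1} + \alpha X + \beta$, where $\beta \in \mathcal{P}$ and $\alpha \in E$ satisfy $\alpha^{q+1} = \beta^q + \beta^{q^2+q+1}$. Generalized quadrangle $W(q)$: its points are those of $\mathcal{P}$, and its lines are the sets $$L(\beta) = \{x \in \mathcal{P} \mid x^{q+1} + (\beta^{(q^2+q+2)/2} + \beta^{(q+1)/2})x + \beta = 0\}, \qquad \beta \in \mathcal{P}.$$ Polarities: $\pi_0$ maps each point $x$ to the line $L(x^{\sqrt{2q}})$ and each line $L(x)$ to the point $x^{1/\sqrt{2q}}$. $\pi_1$ maps each point $x$ to the line $L(x^{q^2\sqrt{2q}})$ and each line $L(x)$ to the point $x^{q^2/\sqrt{2q}}$. Both are polarities of $W(q)$ (a result of Glauberman). A point $x$ is absolute for $\pi_i$ if $x \in \pi_i(x)$. *)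

(* Defs.v *)
(* E is an abstract finite field of order q^4 = 2^(4m);
   any such field is (isomorphic to) F_{q^4}. *)
From HB Require Import structures.
From mathcomp Require Import all_boot all_order all_algebra all_field.
Set Implicit Arguments. Unset Strict Implicit. Unset Printing Implicit Defensive.
Import GRing.Theory.
Local Open Scope ring_scope.

Definition qq (m : nat) : nat := (2 ^ m)%N.
(* sqrt(2q) = 2^((m+1)/2), an integer since m is odd *)
Definition r2q (m : nat) : nat := (2 ^ (m.+1)./2)%N.
Definition ss (m : nat) : nat := (qq m - r2q m + 1)%N.
Definition tt_ (m : nat) : nat := (qq m + r2q m + 1)%N.
Definition NP (m : nat) : nat := (qq m ^ 3 + qq m ^ 2 + qq m + 1)%N.

Section Defs.
Variables (E : finFieldType) (m : nat).
Local Notation q := (qq m).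

Definition Pset : {set E} := [set x : E | x ^+ NP m == 1].
Definition Os : {set E} := [set x : E | x ^+ ss m == 1].
Definition Ot : {set E} := [set x : E | x ^+ tt_ m == 1].

Definition T0 : {set E} :=
  Os :|: [set ((v ^+ (q - 1) + v ^- (q - 1)) ^+ (q - 1)) * u * v
           | u in Os, v in Ot :\ 1].
Definition T1 : {set E} :=
  Ot :|: [set ((u ^+ (q - 1) + u ^- (q - 1)) ^+ (q - 1)) * u * v
           | u in Os :\ 1, v in Ot].

(* beta^((q+1)/2) for beta in P: since |P| = N is odd, the exponent 1/2 is
   read modulo N, i.e. (q+1)/2 := (q+1)(N+1)/2.  (Equivalently: the unique
   square root of beta^(q+1) in E.) *)
Definition half_qp1 : nat := ((q + 1) * (NP m).+1./2)%N.

Definition Lline (beta : E) : {set E} :=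
  [set x in Pset | x ^+ q.+1
                   + (beta ^+ ((q ^ 2 + q + 2)./2) + beta ^+ half_qp1) * x
                   + beta == 0].

Definition is_PG_line (alpha beta : E) : Prop :=
  beta \in Pset /\ alpha ^+ q.+1 = beta ^+ q + beta ^+ (q ^ 2 + q + 1).
Definition PG_line (alpha beta : E) : {set E} :=
  [set x in Pset | x ^+ q.+1 + alpha * x + beta == 0].

Definition is_ovoid (O : {set E}) : Prop :=
  [/\ O \subset Pset, #|O| = (q ^ 2 + 1)%N &
      forall alpha beta : E, is_PG_line alpha beta ->
        #|O :&: PG_line alpha beta| <= 2]%N.

Definition abs_pi0 : {set E} := [set x in Pset | x \in Lline (x ^+ r2q m)].
Definition abs_pi1 : {set E} :=
  [set x in Pset | x \in Lline (x ^+ (q ^ 2 * r2q m))].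
End Defs.

Arguments Pset : clear implicits.
Arguments Os : clear implicits.
Arguments Ot : clear implicits.
Arguments T0 : clear implicits.
Arguments T1 : clear implicits.
Arguments abs_pi0 : clear implicits.
Arguments abs_pi1 : clear implicits.
Arguments Lline : clear implicits.
Arguments PG_line : clear implicits.
Arguments is_PG_line : clear implicits.
Arguments is_ovoid : clear implicits.

(* Main.v *)
(* Put x = y^(q-1): then P is the point set of PG(3,q) on E, and the symplectic form
   Tr(y z^(q^2)) makes x, w orthogonal when
     w^(q+1) + x^(q+1) + x w^(q^2+q+1) + x^(q^2+q+1) w = 0.
   Both polarities come from a field automorphism theta : x |-> x^e with
   theta(theta(x))^2 = x^q, a point x being sent to the line L(theta(x)^2).

   Absolute points: P splits as S O_s O_t, and for x = a u v the condition
   x in L(theta(x)^2) does not involve u; with d = v^2, D = d^q, c = theta(a)^2 it reads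
   c (a d + 1) = d (a + D).  Comparing with its image under Frobenius eliminates c and
   gives a = (1 + d D) / (d + D), which is the coefficient in T_i.

   Ovoid: if two absolute points x, y were orthogonal, the line xy would be
   L(theta(z)^2), and by symmetry of the polarity z would form with x and y a triangle
   of W(q) unless it is x or y; both are impossible.  Thus the q^2+1 absolute points are
   pairwise non-orthogonal, and a variance computation shows that every other point is
   orthogonal to exactly q+1 of them.  Counting incidences between the absolute points
   and the q+1 points orthogonal to a secant then leaves room for two points only. *)
Require Import Defs.
From mathcomp Require Import all_boot all_order all_algebra all_field.
From mathcomp Require Import ring zify.
Set Implicit Arguments. Unset Strict Implicit. Unset Printing Implicit Defensive.
Import GRing.Theory.
Local Open Scope ring_scope.

(** * Counting through fibers and polynomial roots *)

Lemma card_le_fibers (T U : finType) (f : T -> U) (A : {set T}) (B : {set U}) k :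
    (forall x, x \in A -> f x \in B) ->
    (forall u, u \in B -> #|[set x in A | f x == u]| <= k)%N ->
  (#|A| <= #|B| * k)%N.
Proof.
move=> fAB fk; rewrite -sum1_card (partition_big f (mem B)) //= -sum_nat_const.
apply: leq_sum => u uB; rewrite sum1_card; apply: leq_trans (fk u uB).
by apply/eq_leq/eq_card=> x; rewrite !inE.
Qed.

(** Subtracting one element of a fiber from all the others moves the fiber into [K], so no fiber is
    larger than [K]. *)
Lemma card_le_kernel (V : finZmodType) (U : finType) (f : V -> U) (B : {set U})
    (K : {set V}) :
    (forall x, f x \in B) -> (forall x y, f x = f y -> x - y \in K) ->
  (#|V| <= #|B| * #|K|)%N.
Proof.
move=> fB fK; rewrite -cardsT.
apply: (@card_le_fibers _ _ f) => [x _|u _]; first exact: fB.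
case: (set_0Vmem [set x in setT | f x == u]) => [->|[y]]; first by rewrite cards0.
rewrite !inE /= => /eqP fy; rewrite -(card_imset _ (addIr (- y))).
apply/subset_leq_card/subsetP => _ /imsetP[x + ->].
by rewrite !inE /= => /eqP fx; apply: fK; rewrite fx fy.
Qed.

Lemma card_poly_roots (F : finFieldType) (p : {poly F}) :
  p != 0 -> (#|[set x | root p x]| < size p)%N.
Proof.
move=> p0; rewrite cardE; apply: max_poly_roots => //; last exact: enum_uniq.
by apply/allP => x; rewrite mem_enum inE.
Qed.

Lemma card_trinomial_roots (F : finFieldType) n (a b c : F) :
    (1 < n)%N -> a != 0 ->
  (#|[set x | (a * x ^+ n + b * x + c == 0)%R]| <= n)%N.
Proof.
move=> n1 a0; pose p := a *: 'X^n + (b *: 'X + c%:P).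
have szp : size p = n.+1.
  rewrite size_polyDl size_scale ?size_polyXn //.
  apply: leq_ltn_trans (size_polyD _ _) _; rewrite gtn_max size_polyC.
  rewrite (leq_ltn_trans (size_scale_leq _ _)) ?size_polyX //=.
  by case: (c != 0) => //; apply: ltnW.
have := @card_poly_roots F p; rewrite -size_poly_eq0 szp ltnS => /(_ isT).
apply: leq_trans; apply/subset_leq_card/subsetP => x.
by rewrite !inE rootE !(hornerD, hornerZ, hornerX, hornerXn, hornerC) addrA.
Qed.

Lemma card_power_fiber (F : finFieldType) n (c : F) : (0 < n)%N ->
  (#|[set x | (x ^+ n == c)%R]| <= n)%N.
Proof.
move=> n0; have szp := size_XnsubC c n0.
have := @card_poly_roots F ('X^n - c%:P); rewrite -size_poly_eq0 szp ltnS.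
move=> /(_ isT); apply: leq_trans; apply/subset_leq_card/subsetP => x.
by rewrite !inE rootE hornerD hornerN hornerXn hornerC subr_eq0.
Qed.

(** The degree gives the upper bound. For the lower one, if #|F| - 1 = k n, the k-th power map sends
    the nonzero elements into the n-th roots of unity with fibers of size at most k. *)
Lemma card_unity_roots (F : finFieldType) n : (0 < n)%N -> (n %| #|F|.-1)%N ->
  #|[set x : F | x ^+ n == 1]| = n.
Proof.
move=> n0 /dvdnP[k Fk]; apply/eqP; rewrite eqn_leq card_power_fiber //=.
have F1 := finNzRing_gt1 F.
have k0 : (0 < k)%N by case: k Fk => //; move: F1; case: #|F| => [|[]].
rewrite -(leq_pmul2r k0) mulnC -Fk -(cardsC1 (0 : F)).
apply: (@card_le_fibers _ _ (fun x : F => x ^+ k)) => [x|u _].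
  rewrite !inE => x0; rewrite -exprM -Fk; apply/eqP/(mulfI x0).
  by rewrite -exprS prednK ?expf_card ?mulr1 //; apply: ltnW.
apply: leq_trans (card_power_fiber u k0).
by apply/subset_leq_card/subsetP => x; rewrite !inE => /andP[].
Qed.

(** * Sets meeting every plane in 1 or q + 1 points *)

Section Secants.

Variables (T : finType) (q : nat) (P O : {set T}) (r : rel T).
Hypotheses (q1 : (0 < q)%N)
  (cardP : #|P| = ((q ^ 2 + 1) * (q + 1))%N) (cardO : #|O| = (q ^ 2 + 1)%N)
  (sOP : O \subset P) (rxx : forall x, x \in O -> r x x)
  (rO : {in O &, forall x y, r x y -> x = y})
  (card_perp : forall x, x \in O -> (q ^ 2 + q + 1 <= #|[set w in P | r x w]|)%N)
  (card_perp2 : {in O &, forall x y, x != y ->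
      #|[set w in P | r x w && r y w]| <= q + 1}%N).

Let n w := #|[set x in O | r x w]|.

Lemma double_count (A B : {set T}) (s : rel T) :
  (\sum_(w in A) #|[set x in B | s x w]| = \sum_(x in B) #|[set w in A | s x w]|)%N.
Proof.
under eq_bigr do rewrite -sum1dep_card.
under [RHS]eq_bigr do rewrite -sum1dep_card.
by under eq_bigr do rewrite big_mkcondr; rewrite exchange_big /=;
   under eq_bigr do rewrite -big_mkcondr.
Qed.

(** Let K be the sum of n(w) over the points w off [O]. The hypotheses bound the sum of (n(w) - (q +
    1))^2 by (2q + 1)((q^2 + 1)(q^2 + q) - K), while K >= (q^2 + 1)(q^2 + q); hence every term
    vanishes. *)
Lemma perp_card_off w : w \in P :\: O -> n w = (q + 1)%N.
Proof.
pose k x := #|[set w in P :\: O | r x w]|.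
have kge x : x \in O -> (q ^ 2 + q <= k x)%N.
  move=> xO; have := card_perp xO.
  rewrite (cardsD1 x) inE rxx // (subsetP sOP) //= addn1 add1n ltnS.
  move/leq_trans; apply; apply/subset_leq_card/subsetP => z.
  rewrite !inE => /and3P[zx zP rxz]; rewrite zP rxz !andbT; apply: contra zx => zO.
  by rewrite (rO xO zO rxz).
have S1 : (\sum_(w in P :\: O) n w = \sum_(x in O) k x)%N by apply: double_count.
(* n(w)^2 counts ordered pairs of points of [O] orthogonal to w: the diagonal contributes k(x), each
   of the q^2 other points at most q + 1. *)
have S2 : (\sum_(w in P :\: O) n w ^ 2 <=
    \sum_(x in O) (k x + q ^ 2 * (q + 1)))%N.
  have nE w' : (n w' ^ 2 = \sum_(x in O) #|[set y in O | r x w' && r y w']|)%N.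
    rewrite expnS expn1 {1}/n -sum1dep_card big_distrl /= [RHS]big_mkcond /=.
    rewrite big_mkcond /=; apply: eq_bigr => x _.
    case: (x \in O) => //=; case: (r x w') => //=; first by rewrite mul1n.
    by rewrite eq_card0 // => y; rewrite !inE andbF.
  under eq_bigr do rewrite nE.
  rewrite exchange_big /=; apply: leq_sum => x xO.
  rewrite (double_count _ O (fun y w' => r x w' && r y w')).
  rewrite (bigD1 x) //=; apply: leq_add.
    by apply/subset_leq_card/subsetP => z; rewrite !inE andbb.
  have -> : (q ^ 2 = #|O :\ x|)%N.
    by move: cardO; rewrite (cardsD1 x) xO addnC => /addIn.
  rewrite -sum_nat_const; under [X in (_ <= X)%N]eq_bigl do rewrite !inE andbC.
  apply: leq_sum => y /andP[yO yx]; apply: leq_trans (card_perp2 xO yO _); last first.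
    by rewrite eq_sym.
  apply/subset_leq_card/subsetP => z.
  by rewrite !inE => /andP[/andP[_ ->] /andP[-> ->]].
have cardD : #|P :\: O| = ((q ^ 2 + 1) * q)%N.
  rewrite cardsD (setIidPr sOP) cardP cardO; lia.
(* The variance without subtraction: 2 n (q + 1) <= n^2 + (q + 1)^2, with equality exactly for n = q
   + 1. *)
have [leC eqC] := leqif_sum (fun w' (_ : w' \in P :\: O) => nat_Cauchy (n w') (q + 1)).
have lhsE : (\sum_(w' in P :\: O) 2 * (n w' * (q + 1)) =
    2 * ((\sum_(x in O) k x) * (q + 1)))%N by rewrite -big_distrr -big_distrl /= S1.
have rhsE : (\sum_(w' in P :\: O) (n w' ^ 2 + (q + 1) ^ 2) =
    \sum_(w' in P :\: O) n w' ^ 2 + #|P :\: O| * (q + 1) ^ 2)%N.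
  by rewrite big_split /= sum_nat_const.
rewrite lhsE rhsE in leC eqC.
have : (\sum_(x in O) (q ^ 2 + q) <= \sum_(x in O) k x)%N by apply: leq_sum.
rewrite sum_nat_const cardO => kS.
move: S2; rewrite big_split /= sum_nat_const cardO => S2.
have le_sq : (\sum_(i in P :\: O) n i ^ 2 + #|P :\: O| * (q + 1) ^ 2 <=
   2 * ((\sum_(x in O) k x) * (q + 1)))%N.
  rewrite cardD; nia.
move=> wD; apply/eqP; have {eqC} : [forall (i | i \in P :\: O), n i == (q + 1)%N].
  by rewrite -eqC eqn_leq le_sq leC.
by move/forall_inP; apply.
Qed.

(** With c points of [O] on [L] and j points in [M], the former are orthogonal to all of [M] and
    every other point of [O] to at least one element of it. So c j + (q^2 + 1 - c) <= j (q + 1), and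
    j <= q + 1 forces c <= 2. *)
Lemma secant_le2 (L : {set T}) : (2 < q)%N ->
    {in O &, forall x y, x != y -> x \in L -> y \in L ->
      (forall z, z \in L -> forall w, w \in P -> r x w -> r y w -> r z w) /\
      (forall z, z \in O -> exists w, [/\ w \in P, r x w, r y w & r z w])} ->
  (#|O :&: L| <= 2)%N.
Proof.
move=> q2 hL; case: (leqP #|O :&: L| 1) => [/leq_trans->//|].
case/card_gt1P => x [y []]; rewrite !inE => /andP[xO xL] /andP[yO yL] xy.
have [hz hE] := hL x y xO yO xy xL yL.
pose M := [set w in P | r x w && r y w].
have Mn w : w \in M -> n w = (q + 1)%N.
  rewrite !inE => /andP[wP /andP[rxw ryw]]; apply: perp_card_off.
  rewrite inE wP andbT; apply: contra xy => wO.
  by rewrite (rO xO wO rxw) (rO yO wO ryw).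
have := double_count M O r; rewrite (eq_bigr _ Mn) sum_nat_const.
have M0 : (0 < #|M|)%N.
  have [w [wP rx ry _]] := hE x xO; apply/card_gt0P; exists w.
  by rewrite inE wP rx.
have Mq : (#|M| <= q + 1)%N by apply: card_perp2.
rewrite (bigID (mem L)) /= => eM.
have S1 : (#|O :&: L| * #|M| <= \sum_(i in O | i \in L) #|[set w in M | r i w]|)%N.
  rewrite -sum_nat_const; under eq_bigl do rewrite inE.
  apply: leq_sum => z /andP[zO zL]; apply/subset_leq_card/subsetP => w.
  by rewrite !inE => /andP[wP /andP[rx ry]]; rewrite wP rx ry (hz z zL w).
have S2 : (#|O :\: L| <= \sum_(i in O | i \notin L) #|[set w in M | r i w]|)%N.
  rewrite -sum1_card; under eq_bigl do rewrite inE andbC.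
  apply: leq_sum => z /andP[zO _]; have [w [wP rx ry rz]] := hE z zO.
  by apply/card_gt0P; exists w; rewrite !inE wP rx ry rz.
have := cardsID L O; rewrite cardO => cO.
move: eM S1 S2 cO M0 Mq; move: (\sum_(_ in _ | _) _)%N (\sum_(_ in _ | _) _)%N.
move: #|O :&: L| #|O :\: L| #|M| => c1 c2 j s1 s2 *.
rewrite leqNgt; apply/negP => c1_gt; nia.
Qed.

End Secants.

(** * Roots of unity of coprime orders *)

Lemma coprime_root1 (R : unitRingType) (x : R) a b :
  (0 < a)%N -> coprime a b -> x ^+ a = 1 -> x ^+ b = 1 -> x = 1.
Proof.
move=> a0 cab xa xb; case: (egcdnP b a0) => u v e _.
have := congr1 (GRing.exp x) e; rewrite exprD !(mulnC _ a) !(mulnC _ b) !exprM.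
by rewrite xa xb !expr1n mul1r (eqP cab) expr1.
Qed.

(** The exponents i = (1, 0) and j = (0, 1) modulo (a, b) add up to 1 modulo a b, so x = x^i x^j. *)
Lemma coprime_root_split (R : pzRingType) (x : R) a b :
    coprime a b -> x ^+ (a * b) = 1 ->
  exists y z, [/\ x = y * z, y ^+ a = 1 & z ^+ b = 1].
Proof.
move=> cab xab; pose i := chinese a b 1 0; pose j := chinese a b 0 1.
have bi : (b %| i)%N.
  by have := chinese_modr cab 1 0; rewrite -/i mod0n => /eqP.
have aj : (a %| j)%N.
  by have := chinese_modl cab 0 1; rewrite -/j mod0n => /eqP.
have xmod k l : k = l %[mod a * b] -> x ^+ k = x ^+ l.
  by move=> kl; rewrite -(expr_mod k xab) kl expr_mod.
exists (x ^+ i), (x ^+ j); split.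
- rewrite -exprD -[LHS]expr1; apply/xmod/eqP; rewrite eq_sym chinese_remainder //.
  rewrite -(modnDm i j a) -(modnDm i j b) (chinese_modl cab 1 0) (chinese_modr cab 0 1).
  by rewrite (eqP aj) (eqP bi) addn0 add0n !modn_mod !eqxx.
- by case/dvdnP: bi => k ->; rewrite -exprM mulnAC -mulnA mulnC exprM xab expr1n.
- by case/dvdnP: aj => k ->; rewrite -exprM -mulnA mulnC exprM xab expr1n.
Qed.

(** * The cyclic model of W(q) *)

Section CyclicModel.

Variables (E : finFieldType) (q : nat).
Hypotheses (char2 : 2%:R = 0 :> E) (cardE : #|E| = (q ^ 4)%N) (q2 : (2 < q)%N)
  (frobD : forall x y : E, (x + y) ^+ q = x ^+ q + y ^+ q).

Local Notation fr x := (x ^+ q).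

(** The elements of norm 1 over the field of q elements, with the norm written as a product of
    conjugates so that it can enter ring identities. *)
Definition Cyc : {set E} := [set x | x * fr x * fr (fr x) * fr (fr (fr x)) == 1].

Lemma cyc_exp x : (x \in Cyc) = (x ^+ ((q ^ 2 + 1) * (q + 1)) == 1).
Proof.
rewrite inE -!exprM -exprS -!exprD; congr (_ ^+ _ == 1).
by clear; rewrite !expnS; lia.
Qed.

(* The symplectic form Tr(y z^(q^2)) with x = y^(q-1), w = z^(q-1), divided by y z. *)
Definition perp (x w : E) : bool :=
  w * fr w + x * fr x + x * (w * fr w * fr (fr w)) + x * fr x * fr (fr x) * w == 0.

Definition on_line (alpha beta x : E) : bool := x * fr x + alpha * x + beta == 0.

(* The line L(b^2); using b instead of beta = b^2 clears the halved exponents. *)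
Definition wline (b : E) : pred E :=
  on_line (b ^+ 2 * fr b * fr (fr b) + b * fr b) (b ^+ 2).

Let c3 : 3%:R = 1 :> E. Proof. by rewrite -[3%N]/(2 + 1)%N natrD char2 add0r. Qed.
Let c4 : 4%:R = 0 :> E. Proof. by rewrite -[4%N]/(2 + 2)%N natrD char2 add0r. Qed.
Let cN : -1 = 1 :> E.
Proof. by apply/esym/eqP; rewrite -subr_eq0 opprK -[_ + _]/(2%:R) char2. Qed.
Let cN2 : -2%:R = 0 :> E. Proof. by rewrite char2 oppr0. Qed.

(* [ring] only uses an equation on numerals for syntactically equal coefficients, so
   reduction modulo 2 needs one equation for each coefficient that occurs. *)
Ltac ring2 := ring: char2 c3 c4 cN cN2.

Lemma oppr2 (x : E) : - x = x. Proof. by rewrite -mulN1r cN mul1r. Qed.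

Lemma addr2_eq0 (x y : E) : (x + y == 0) = (x == y).
Proof. by rewrite -{1}[y]oppr2 subr_eq0. Qed.

Lemma sqr2D (x y : E) : (x + y) ^+ 2 = x ^+ 2 + y ^+ 2. Proof. ring2. Qed.

Lemma sqr2_inj : injective (fun x : E => x ^+ 2).
Proof.
by move=> x y /eqP; rewrite -addr2_eq0 -sqr2D expf_eq0 /= addr2_eq0 => /eqP.
Qed.

Lemma frob4 (x : E) : fr (fr (fr (fr x))) = x.
Proof.
by rewrite -!exprM -[RHS]expf_card cardE; congr (_ ^+ _); rewrite !expnS; lia.
Qed.

Lemma frob_inj : injective (fun x : E => fr x).
Proof. by move=> x y /= e; rewrite -(frob4 x) e frob4. Qed.

Lemma frob0 : fr 0 = 0 :> E. Proof. by rewrite expr0n; case: q q2. Qed.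

Lemma cyc_neq0 x : x \in Cyc -> x != 0.
Proof.
by rewrite inE; apply: contraTneq => ->; rewrite !mul0r eq_sym oner_neq0.
Qed.

Lemma perpxx x : perp x x.
Proof. by apply/eqP; ring2. Qed.

(** For y nonzero this is y times the left side of [perp x (y ^+ (q - 1))]; unlike [perp] it is
    additive in y. *)
Let form (x y : E) : E :=
  fr (fr y) + x * fr x * y + x * fr (fr (fr y)) + x * fr x * fr (fr x) * fr y.

Let formB x y z : form x (y - z) = form x y - form x z.
Proof. by rewrite /form [- z]oppr2 [- (_ + _)]oppr2 !frobD; ring. Qed.

(** Confines the values of the form to the at most q solutions t of x t^q = t, which makes its
    kernel large. *)
Let form_val x y : x \in Cyc -> x * fr (form x y) = form x y.
Proof.
rewrite inE /form => /eqP xP; rewrite !frobD !exprMn frob4.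
rewrite !mulrDr !mulrA xP mul1r; ring.
Qed.

Let form_root x y : y != 0 -> form x y = 0 ->
  perp x (y ^+ (q - 1)) && (y ^+ (q - 1) \in Cyc).
Proof.
move=> y0; set w := y ^+ (q - 1).
have y1 : fr y = y * w by rewrite /w -exprS subn1 prednK // ltnW // ltnW.
have y2 : fr (fr y) = y * w * fr w by rewrite {1}y1 exprMn y1.
have y3 : fr (fr (fr y)) = y * w * fr w * fr (fr w) by rewrite {1}y2 !exprMn y1.
have y4 : fr (fr (fr (fr y))) = y * w * fr w * fr (fr w) * fr (fr (fr w)).
  by rewrite {1}y3 !exprMn y1.
rewrite /form y3 y2 y1 => f0; apply/andP; split.
  by rewrite /perp -(mulrI_eq0 _ (mulfI y0)) -f0; apply/eqP; ring.
by rewrite inE -(inj_eq (mulfI y0)) !mulrA -y4 frob4 mulr1.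
Qed.

Let card_form_values x : x \in Cyc -> (#|[set t : E | (x * fr t == t)%R]| <= q)%N.
Proof.
move/cyc_neq0=> x0; apply: leq_trans (@card_trinomial_roots E q x (-1) 0 _ x0).
  by apply/subset_leq_card/subsetP => t; rewrite !inE addr0 mulN1r subr_eq0.
exact: ltnW.
Qed.

(** The kernel of the form has at least q^3 elements, and y |-> y^(q-1) is at most (q - 1)-to-one on
    the nonzero ones; (q^3 - 1)/(q - 1) = q^2 + q + 1. *)
Lemma card_perp x : x \in Cyc ->
  (q ^ 2 + q + 1 <= #|[set w in Cyc | perp x w]|)%N.
Proof.
move=> xP; set K := [set y | form x y == 0].
have cK : (q ^ 4 <= q * #|K|)%N.
  rewrite -cardE; apply: leq_trans (leq_mul (card_form_values xP) (leqnn _)).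
  apply: (@card_le_kernel _ _ (form x)) => [y|y z eyz]; first by rewrite inE form_val.
  by rewrite inE formB eyz subrr.
have K0 : 0 \in K by rewrite inE /form !frob0 !mulr0 !addr0.
move: cK; rewrite (cardsD1 0) K0 => cK.
have : (#|K :\ 0%R| <= #|[set w in Cyc | perp x w]| * (q - 1))%N.
  apply: (@card_le_fibers E E (fun y : E => y ^+ (q - 1))) => [y|y _].
    by rewrite !inE => /andP[y0 /eqP /(form_root y0)]; rewrite inE andbC.
  have q1 : (0 < q - 1)%N by rewrite subn_gt0 ltnW.
  apply: leq_trans (card_power_fiber y q1).
  by apply/subset_leq_card/subsetP => t; rewrite !inE => /andP[].
move: cK; move: #|_| #|_| => c d; rewrite subn1 => h1 h2.
have := ltnW (ltnW q2); nia.
Qed.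

(** The combination y [perp x w] + x [perp y w] cancels the term w^(q^2+q+1) and leaves a trinomial
    of degree q + 1 in w with leading coefficient x + y. *)
Lemma card_perp2 x y : x != y ->
  (#|[set w in Cyc | perp x w && perp y w]| <= q + 1)%N.
Proof.
move=> xy; rewrite addn1; have q1 : (1 < q.+1)%N by rewrite ltnS ltnW ?(ltnW q2).
have s0 : x + y != 0 by rewrite addr2_eq0.
apply: leq_trans (card_trinomial_roots
  (x * fr x * fr (fr x) * y + x * y * fr y * fr (fr y))
  (x * fr x * y + x * y * fr y) q1 s0).
apply/subset_leq_card/subsetP => w; rewrite !inE exprS => /and3P[_].
move=> /eqP hx /eqP hy; apply/eqP.
transitivity (y * 0 + x * 0 : E); last by rewrite !mulr0 addr0.
rewrite -{1}hx -hy; ring2.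
Qed.

(** Three forms take at most q^3 joint values on q^4 elements, so they have a common nonzero
    zero. *)
Lemma exists_perp3 x y z : x \in Cyc -> y \in Cyc -> z \in Cyc ->
  exists w, [/\ w \in Cyc, perp x w, perp y w & perp z w].
Proof.
move=> xP yP zP; pose B x := [set t : E | x * fr t == t].
set K := [set t | [&& form x t == 0, form y t == 0 & form z t == 0]].
have : (#|E| <= #|setX (setX (B x) (B y)) (B z)| * #|K|)%N.
  apply: (@card_le_kernel _ _ (fun t : E => (form x t, form y t, form z t))) => [t|t u].
    by rewrite !inE !form_val ?eqxx.
  by case=> ex ey ez; rewrite !inE !formB ex ey ez !subrr eqxx.
rewrite !cardsX cardE => cK.
have {}cK : (1 < #|K|)%N.
  have := card_form_values xP; have := card_form_values yP.
  have := card_form_values zP; rewrite -!/(B _) => hz hy hx.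
  have hB : (#|B x| * #|B y| * #|B z| <= q ^ 3)%N.
    by rewrite !expnS expn0 muln1 mulnA !leq_mul.
  have := leq_trans cK (leq_mul hB (leqnn _)).
  have q3 : (0 < q ^ 3)%N by rewrite expn_gt0; case: q q2.
  by rewrite expnSr leq_pmul2l // => /(leq_trans _) -> //; apply: ltnW.
have : (0 < #|K :\ 0%R|)%N.
  by move: cK; rewrite (cardsD1 0); case: (0 \in K); case: #|_|.
case/card_gt0P => t; rewrite !inE => /and4P[t0 /eqP hx /eqP hy /eqP hz].
have /andP[px wP] := form_root t0 hx; have /andP[py _] := form_root t0 hy.
by have /andP[pz _] := form_root t0 hz; exists (t ^+ (q - 1)).
Qed.

(** The line equation reduces x^(q+1) and x^(q^2+q+1) to affine expressions in x. For fixed w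
    orthogonality is thus affine in x, and two points of a line decide it for all. *)
Let perp_line alpha beta x w : on_line alpha beta x ->
  perp x w = ((w * fr w * fr (fr w) + alpha
               + (fr alpha * alpha + fr beta) * w) * x
    + (w * fr w + beta + fr alpha * beta * w) == 0).
Proof.
move=> /eqP hx; have x1 : x * fr x = alpha * x + beta.
  by apply/eqP; rewrite -addr2_eq0 addrA; apply/eqP.
have x2 : fr x * fr (fr x) = fr alpha * fr x + fr beta.
  by rewrite -exprMn x1 frobD exprMn.
have x3 : x * fr x * fr (fr x) = fr alpha * (alpha * x + beta) + fr beta * x.
  by rewrite -mulrA x2 -x1; ring.
by rewrite /perp x3 x1; congr (_ == 0); ring.
Qed.

Let affine_root2 (a c x y : E) :
  x != y -> a * x + c = 0 -> a * y + c = 0 -> a = 0 /\ c = 0.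
Proof.
move=> xy hx hy; have /eqP : a * (x - y) = 0.
  by rewrite -(subr0 0) -{1}hx -hy; ring.
rewrite mulf_eq0 subr_eq0 (negPf xy) orbF => /eqP a0; split=> //.
by rewrite -hx a0 mul0r add0r.
Qed.

Lemma perp_span alpha beta x y z w : x != y ->
    on_line alpha beta x -> on_line alpha beta y -> on_line alpha beta z ->
  perp x w -> perp y w -> perp z w.
Proof.
move=> xy lx ly lz; rewrite !(@perp_line alpha beta) //.
by move=> /eqP hx /eqP hy; have [-> ->] := affine_root2 xy hx hy; rewrite mul0r addr0.
Qed.

(** By this identity the constant term in [perp_line] is the equation of the line itself, evaluated
    at w; this makes the line totally isotropic. *)
Let wline_coef b : b \in Cyc ->
  fr (b ^+ 2 * fr b * fr (fr b) + b * fr b) * b ^+ 2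
    = b ^+ 2 * fr b * fr (fr b) + b * fr b.
Proof.
rewrite inE frobD !exprMn => /eqP bP.
transitivity (b * fr b * (b * fr b * fr (fr b) * fr (fr (fr b)))
   + b ^+ 2 * fr b * fr (fr b)); first by ring.
by rewrite bP; ring.
Qed.

Lemma wline_perp b x w : b \in Cyc -> wline b x -> wline b w -> perp x w.
Proof.
move=> bP lx lw; rewrite (perp_line _ lx) wline_coef // addrAC.
move: lw lx; rewrite /wline /on_line; have := wline_coef bP.
set al := _ + _; set be := b ^+ 2 => hal /eqP lw _.
have w1 : w * fr w = al * w + be by apply/eqP; rewrite -addr2_eq0 addrA lw.
have w2 : fr w * fr (fr w) = fr al * fr w + fr be by rewrite -exprMn w1 frobD exprMn.
have w3 : w * fr w * fr (fr w) = fr al * (al * w + be) + fr be * w.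
  by rewrite -mulrA w2 -w1; ring.
rewrite w3 w1 mulrDr hal; apply/eqP; ring2.
Qed.

Lemma perp_wline b x y w : b \in Cyc -> x != y -> wline b x -> wline b y ->
  perp x w -> perp y w -> wline b w.
Proof.
move=> bP xy lx ly; rewrite (perp_line _ lx) (perp_line _ ly) wline_coef //.
move=> /eqP hx /eqP hy; have [_ c0] := affine_root2 xy hx hy.
by rewrite /wline /on_line addrAC c0.
Qed.

Lemma wline_inj b c x y : x != y ->
  wline b x -> wline b y -> wline c x -> wline c y -> b = c.
Proof.
rewrite /wline /on_line; set al := (b ^+ 2 * _ * _ + _).
set al' := (c ^+ 2 * _ * _ + _).
move=> xy /eqP hbx /eqP hby /eqP hcx /eqP hcy.
have [||_ /eqP] := @affine_root2 (al - al') (b ^+ 2 - c ^+ 2) x y xy.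
- by rewrite -(subr0 0) -{1}hbx -hcx; ring.
- by rewrite -(subr0 0) -{1}hby -hcy; ring.
by rewrite subr_eq0 => /eqP /sqr2_inj.
Qed.

Lemma exists_wline x y : x \in Cyc -> y \in Cyc -> x != y -> perp x y ->
  exists b, [/\ b \in Cyc, wline b x & wline b y].
Proof.
rewrite !inE => /eqP xP /eqP yP xy /eqP pxy; set s := x + y.
have s0 : s != 0 by rewrite addr2_eq0.
have [g _ gK] := injF_bij sqr2_inj.
(* Solving the two equations of a line through x and y gives alpha = (x^(q+1) + y^(q+1)) / s and
   beta = x y s^q / s; b is the square root of this beta. *)
have [b b2] : exists b, b ^+ 2 = x * y * fr s / s by eexists; apply: gK.
have fs0 (z : E) : z != 0 -> fr z != 0 by apply: expf_neq0.
have s10 := fs0 _ s0; have s20 := fs0 _ s10; have s30 := fs0 _ s20.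
have frb z : fr z ^+ 2 = fr (z ^+ 2) by rewrite exprAC.
have b12 : fr b ^+ 2 = fr x * fr y * fr (fr s) / fr s.
  by rewrite frb b2 !(exprMn, exprVn).
have b22 : fr (fr b) ^+ 2 = fr (fr x) * fr (fr y) * fr (fr (fr s)) / fr (fr s).
  by rewrite frb b12 !(exprMn, exprVn).
have b32 : fr (fr (fr b)) ^+ 2 = fr (fr (fr x)) * fr (fr (fr y)) * s / fr (fr (fr s)).
  by rewrite frb b22 !(exprMn, exprVn) frob4.
exists b.
(* Orthogonality enters here: it makes the alpha of the joining line agree with the coefficient
   prescribed by b. Squaring leaves only the known powers of b^2. *)
have alE : b ^+ 2 * fr b * fr (fr b) + b * fr b = (x * fr x + y * fr y) / s.
  apply: sqr2_inj; rewrite sqr2D !exprMn b12 b22 b2 !exprVn.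
  move: pxy xP yP s0 s10 s20; rewrite !frobD /s.
  set x1 := fr x; set x2 := fr x1; set x3 := fr x2.
  set y1 := fr y; set y2 := fr y1; set y3 := fr y2 => pxy xP yP s0 s10 s20.
  have e : x * x1 + y * y1 = x * y * (x1 * x2 + y1 * y2).
    by apply/eqP; rewrite -addr2_eq0; apply/eqP; rewrite -[RHS]pxy; ring.
  have e' : x * y * x1 * y1 * x2 * y2 * (x1 + y1) * (x3 + y3) =
      (y * y1 * y2) * (x1 + y1) + (x * x1 * x2) * (x1 + y1).
    rewrite -[y * y1 * y2]mul1r -[x * x1 * x2]mul1r -{1}xP -yP; ring.
  transitivity (x * y * (x1 * y1 * (x2 + y2) * (x + y) +
     x * y * x1 * y1 * x2 * y2 * (x1 + y1) * (x3 + y3)) / (x + y) ^+ 2).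
    by field; rewrite s0 s10 s20.
  rewrite e' [in RHS]expr2 {1}e; congr (_ / _); ring2.
split.
- rewrite inE; apply/eqP/sqr2_inj; rewrite !exprMn b32 b22 b12 b2 expr1n.
  transitivity ((x * fr x * fr (fr x) * fr (fr (fr x)))
    * (y * fr y * fr (fr y) * fr (fr (fr y)))); last by rewrite xP yP mul1r.
  by field; rewrite s0 s10 s20 s30.
- rewrite /wline /on_line alE b2 frobD; apply/eqP.
  transitivity ((2%:R * (x * x * fr x + x * y * fr x + x * y * fr y)) / s).
    by rewrite /s; field.
  by rewrite char2 !mul0r.
- rewrite /wline /on_line alE b2 frobD; apply/eqP.
  transitivity ((2%:R * (y * y * fr y + x * y * fr x + x * y * fr y)) / s).
    by rewrite /s; field.
  by rewrite char2 !mul0r.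
Qed.

(** * Polarities given by a field automorphism, and their absolute points *)

Section Polarity.

Variable e : nat.
Hypotheses (polD : forall x y : E, (x + y) ^+ e = x ^+ e + y ^+ e)
  (pol2 : forall x : E, (x ^+ e ^+ e) ^+ 2 = fr x).

Definition absolute : {set E} := [set x in Cyc | wline (x ^+ e) x].

Let pol_inj : injective (fun x : E => x ^+ e).
Proof. by move=> x y /= exy; apply: frob_inj; rewrite /= -!pol2 exy. Qed.

Let pol0 : 0 ^+ e = 0 :> E.
Proof.
apply/eqP; rewrite expr0n; case: (e =P 0%N) => [e0|//].
have /(_ _)/eqP := @pol_inj 0 1; rewrite /= e0 !expr0 eq_sym oner_eq0.
by move/(_ (erefl _)).
Qed.

Lemma cyc_pol x : (x ^+ e \in Cyc) = (x \in Cyc).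
Proof.
rewrite !inE -[in RHS](inj_eq pol_inj) expr1n !exprMn.
by rewrite ![_ ^+ q ^+ e]exprAC.
Qed.

(* Applying the map x |-> (x^e)^2 to the condition for z turns it into a linear
   combination of the condition for x and of its image under Frobenius. *)
Lemma wline_sym x z : x \in Cyc -> z \in Cyc ->
  wline (z ^+ e) x -> wline (x ^+ e) z.
Proof.
move=> xP; rewrite -cyc_pol; have x0 := cyc_neq0 xP; move: xP.
rewrite !inE /wline /on_line; set b := z ^+ e => /eqP xP /eqP bP /eqP h0.
have frob_pol t : fr t ^+ e = fr (t ^+ e) by rewrite exprAC.
have frob_sqr t : fr t ^+ 2 = fr (t ^+ 2) by rewrite exprAC.
have h1 : fr (x * fr x
    + (b ^+ 2 * fr b * fr (fr b) + b * fr b) * x + b ^+ 2) = 0 by rewrite h0 frob0.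
rewrite -(inj_eq pol_inj) -(inj_eq sqr2_inj) pol0 !(polD, exprMn) !frob_pol -/b.
rewrite !sqr2D -(inj_eq (mulfI x0)) expr0n /= mulr0.
move: h0 h1 xP; rewrite !(frobD, exprMn); have := pol2 x; set s := x ^+ e ^+ e => s2.
have s12 : fr s ^+ 2 = fr (fr x) by rewrite frob_sqr s2.
have s22 : fr (fr s) ^+ 2 = fr (fr (fr x)) by rewrite frob_sqr s12.
rewrite -s22 -s12 -s2 => h0 h1 xP; apply/eqP.
transitivity (b ^+ 2 * x * 0 + s ^+ 2 * 0 + s ^+ 2 * b ^+ 2 * (1 - 1)
  + x * b * fr b * s ^+ 2 * (1 - 1)); last by rewrite !subrr !mulr0 !addr0.
rewrite -{1}h1 -h0 -{1}xP -{2}bP; ring2.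
Qed.

(** By symmetry b lies on the lines of x and y, so it is orthogonal to both and lies on its own
    line. Then b and x, if distinct, would be two common points of their lines, forcing b = x; the
    same holds for y, but x and y differ. *)
Lemma wline_third b x y : b \in Cyc -> x \in Cyc -> y \in Cyc -> x != y ->
    wline (x ^+ e) x -> wline (y ^+ e) y ->
  wline (b ^+ e) x -> wline (b ^+ e) y -> False.
Proof.
have key u v : u \in Cyc -> v \in Cyc -> u != v -> wline (u ^+ e) u ->
    wline (v ^+ e) u -> wline (v ^+ e) v -> wline (u ^+ e) v -> False.
  move=> uP vP uv uu vu vv uv'; have := wline_inj uv uu uv' vu vv.
  by move/pol_inj/eqP; apply/negP.
move=> bP xP yP xy xx yy bx by_.
have xb : wline (x ^+ e) b by apply: wline_sym.
have yb : wline (y ^+ e) b by apply: wline_sym.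
have pbx : perp x b by apply: wline_perp xx xb; rewrite cyc_pol.
have pby : perp y b by apply: wline_perp yy yb; rewrite cyc_pol.
have bb : wline (b ^+ e) b by apply: perp_wline xy bx by_ pbx pby; rewrite cyc_pol.
have [exb|nxb] := eqVneq x b; last exact: (key x b).
by apply: (key y b) => //; rewrite -exb eq_sym.
Qed.

Lemma absolute_perp : {in absolute &, forall x y, perp x y -> x = y}.
Proof.
move=> x y /setIdP[xP xx] /setIdP[yP yy] pxy.
have [//|xy] := eqVneq x y; exfalso.
have [b [bP bx by_]] := exists_wline xP yP xy pxy.
have [g _ gK] := injF_bij pol_inj.
have [z zb] : exists z, z ^+ e = b by eexists; apply: gK.
by apply: (@wline_third z x y); rewrite ?zb // -cyc_pol zb.
Qed.

Lemma absolute_line_le2 alpha beta :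
    #|Cyc| = ((q ^ 2 + 1) * (q + 1))%N -> #|absolute| = (q ^ 2 + 1)%N ->
  (#|absolute :&: [set x in Cyc | on_line alpha beta x]| <= 2)%N.
Proof.
have sub : absolute \subset Cyc by apply/subsetP => x /setIdP[].
move=> cC cO; apply: (@secant_le2 _ q Cyc absolute perp) => //.
- exact: leq_trans q2.
- by move=> x _; apply: perpxx.
- exact: absolute_perp.
- by move=> x /(subsetP sub); apply: card_perp.
- by move=> x y _ _; apply: card_perp2.
move=> x y /(subsetP sub) xP /(subsetP sub) yP xy.
move=> /setIdP[_ lx] /setIdP[_ ly].
split=> [z|z /(subsetP sub) zP]; last exact: exists_perp3.
by move=> /setIdP[_ lz] w _; apply: perp_span lx ly lz.
Qed.

(** * Explicit form and number of the absolute points *)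

Variables n1 n2 : nat.
Hypotheses (n12 : (n1 * n2 = q ^ 2 + 1)%N) (cop12 : coprime n1 n2)
  (copq : coprime (q ^ 2 + 1) (q + 1))
  (polU : forall u : E, u ^+ n1 = 1 -> (u ^+ e) ^+ 2 = u * fr u)
  (polV : forall v : E, v ^+ n2 = 1 -> (v ^+ e) ^+ 2 * (v * fr v) = 1).

Definition coef (v : E) : E := (v ^+ (q - 1) + v ^- (q - 1)) ^+ (q - 1).

Let unitU (u : E) : u ^+ n1 = 1 -> u * fr (fr u) = 1.
Proof. by move=> u1; rewrite -exprM -exprS mulnn -addn1 -n12 exprM u1 expr1n. Qed.

Let unitV (v : E) : v ^+ n2 = 1 -> v * fr (fr v) = 1.
Proof.
by move=> v1; rewrite -exprM -exprS mulnn -addn1 -n12 mulnC exprM v1 expr1n.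
Qed.

Let inv_eq (x y : E) : x * y = 1 -> x != 0 /\ y = x^-1.
Proof.
move=> xy; have x0 : x != 0.
  by apply: contra_eq_neq xy => ->; rewrite mul0r eq_sym oner_neq0.
by split=> //; rewrite -[RHS]mulr1 -xy mulKf.
Qed.

(** After squaring, theta(x) occurs only through theta(x)^2, which is known on u and v. Frobenius
    inverts a and its square inverts u and v, so u splits off as a nonzero factor. *)
Lemma wline_factor a u v : a * fr a = 1 -> u ^+ n1 = 1 -> v ^+ n2 = 1 ->
  wline ((a * u * v) ^+ e) (a * u * v) =
  ((a ^+ e) ^+ 2 * (a * v ^+ 2 + 1) == v ^+ 2 * (a + fr v ^+ 2)).
Proof.
move=> a1 hu hv; rewrite /wline /on_line -(inj_eq sqr2_inj) expr0n /=.
have [u0 u2] := inv_eq (unitU hu); have [v0 v2] := inv_eq (unitV hv).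
have [a0 aE] := inv_eq a1; have fu0 : fr u != 0 by apply: expf_neq0.
have fv0 : fr v != 0 by apply: expf_neq0.
set c := (a ^+ e) ^+ 2.
have c0 : c != 0 by rewrite !expf_neq0.
have cE : fr c = c^-1.
  by rewrite /c -(exprAC a) -exprAC -(exprAC a) aE !exprVn.
have tE : ((a * u * v) ^+ e) ^+ 2 = c * (u * fr u) / (v * fr v).
  rewrite !exprMn (@polU u hu) -/c; congr (_ * _).
  by have [_ <-] := inv_eq (etrans (mulrC _ _) (@polV v hv)).
have frob_sqr (t : E) : fr t ^+ 2 = fr (t ^+ 2) by rewrite exprAC.
clearbody c; set x := a * u * v; set b := x ^+ e in tE *.
have -> : (x * fr x + (b ^+ 2 * fr b * fr (fr b) + b * fr b) * x + b ^+ 2) ^+ 2 =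
    x ^+ 2 * fr x ^+ 2 + ((b ^+ 2) ^+ 2 * fr (b ^+ 2) * fr (fr (b ^+ 2))
     + b ^+ 2 * fr (b ^+ 2)) * x ^+ 2 + (b ^+ 2) ^+ 2.
  by rewrite -!frob_sqr; ring2.
have xE : fr x = fr u * fr v / a by rewrite /x !exprMn aE; ring.
have t1 : fr (c * (u * fr u) / (v * fr v)) = c^-1 * (fr u / u) / (fr v / v).
  by rewrite !(exprMn, exprVn) cE u2 v2.
have t2 : fr (c^-1 * (fr u / u) / (fr v / v)) = c / (u * fr u) * (v * fr v).
  rewrite !(exprMn, exprVn) cE u2 v2 invrK; field.
  by rewrite fu0 fv0 u0 v0 oner_neq0.
rewrite tE t1 t2 xE /x -(addr2_eq0 (c * _)).
transitivity ((((u * fr u) / (v * fr v)) ^+ 2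
   * (c * (a * v ^+ 2 + 1) + v ^+ 2 * (a + fr v ^+ 2)) ^+ 2 == 0)).
  rewrite sqr2D !exprMn !sqr2D; congr (_ == 0); field.
  by rewrite ?fu0 ?fv0 ?u0 ?v0 ?a0 ?c0 ?oner_neq0.
rewrite -exprMn expf_eq0 mulf_eq0 /= mulf_eq0 mulf_eq0 invr_eq0 mulf_eq0.
by rewrite (negPf u0) (negPf v0) (negPf fu0) (negPf fv0).
Qed.

Let frob_add_neq0 (v : E) : v ^+ n2 = 1 -> v != 1 -> v + fr v != 0.
Proof.
move=> hv v1; rewrite addr2_eq0; apply: contra v1 => /eqP ev.
have := unitV hv; rewrite -!ev => /eqP; rewrite -expr2 -{1}(expr1n E 2).
by rewrite (inj_eq sqr2_inj).
Qed.

(** Frobenius turns v v^q = 1 into v^q = v, the case already excluded. *)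
Let frob_mul_neq1 (v : E) : v ^+ n2 = 1 -> v != 1 -> 1 + v * fr v != 0.
Proof.
move=> hv v1; have := frob_add_neq0 hv v1; apply: contra.
have [v0 v2] := inv_eq (unitV hv).
rewrite addr2_eq0 addr2_eq0 => /eqP /esym e1; have := congr1 (fun x : E => fr x) e1.
by rewrite /= expr1n exprMn v2 => e2; rewrite -[fr v](divfK v0) e2 mul1r.
Qed.

Let frobKq (x : E) : x != 0 -> fr x / x = x ^+ (q - 1).
Proof.
move=> x0; apply: (mulfI x0); rewrite -exprS subn1 prednK ?(ltnW (ltnW q2)) //.
by rewrite mulrC divfK.
Qed.

(** The base of the power is w = (v + v^q)^2 / v^(q+1), and w^(q-1) = w^q / w. *)
Lemma coefE v : v ^+ n2 = 1 -> v != 1 ->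
  coef v = (1 + v * fr v) ^+ 2 / (v + fr v) ^+ 2.
Proof.
move=> hv v1; have [v0 v2] := inv_eq (unitV hv).
have fv0 : fr v != 0 by apply: expf_neq0.
have d0 := frob_add_neq0 hv v1.
have wE : v ^+ (q - 1) + v ^- (q - 1) = (v + fr v) ^+ 2 / (v * fr v).
  by rewrite -frobKq // sqr2D; field; rewrite fv0 v0.
have w0 : (v + fr v) ^+ 2 / (v * fr v) != 0.
  by rewrite !(mulf_neq0, expf_neq0, invr_neq0).
have fw : fr ((v + fr v) ^+ 2) = (v^-1 + fr v) ^+ 2.
  by rewrite exprAC frobD v2 addrC.
have fB : fr (v * fr v) = fr v / v by rewrite exprMn v2.
rewrite /coef wE -frobKq // [fr (_ / _)]exprMn exprVn fw fB; field.
by rewrite fv0 v0 d0.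
Qed.

(** Frobenius interchanges 1 + v v^q and v + v^q, up to the common factor 1/v. *)
Lemma coef_unit v : v ^+ n2 = 1 -> v != 1 -> coef v * fr (coef v) = 1.
Proof.
move=> hv v1; have [v0 v2] := inv_eq (unitV hv).
have d0 := frob_add_neq0 hv v1; have n0 := frob_mul_neq1 hv v1.
have fv0 : fr v != 0 by apply: expf_neq0.
have fn : fr ((1 + v * fr v) ^+ 2) = (1 + fr v / v) ^+ 2.
  by rewrite exprAC frobD expr1n exprMn v2.
have fd : fr ((v + fr v) ^+ 2) = (fr v + v^-1) ^+ 2 by rewrite exprAC frobD v2.
rewrite coefE // exprMn exprVn fn fd; field.
by rewrite d0 v0 addrC mulrC n0.
Qed.

Let coef_factor v : v ^+ n2 = 1 -> v != 1 ->
  (coef v ^+ e) ^+ 2 * (coef v * v ^+ 2 + 1) = v ^+ 2 * (coef v + fr v ^+ 2).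
Proof.
move=> hv v1; have [v0 v2] := inv_eq (unitV hv).
have d0 := frob_add_neq0 hv v1; have n0 := frob_mul_neq1 hv v1.
have fv0 : fr v != 0 by apply: expf_neq0.
have tv : (v ^+ e) ^+ 2 = (v * fr v)^-1.
  by have [_ ->] := inv_eq (etrans (mulrC _ _) (@polV v hv)).
have tfv : (fr v ^+ e) ^+ 2 = v / fr v.
  rewrite [fr v ^+ e]exprAC exprAC tv exprVn exprMn v2; field.
  by rewrite fv0 v0.
have v2n1 : v != 1 -> 1 + v != 0 by rewrite addr2_eq0 eq_sym.
have tau : (coef v ^+ e) ^+ 2 =
    (1 + (v ^+ e) ^+ 2 * (fr v ^+ e) ^+ 2) ^+ 2
      / ((v ^+ e) ^+ 2 + (fr v ^+ e) ^+ 2) ^+ 2.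
  rewrite coefE // exprMn exprVn ![_ ^+ 2 ^+ e]exprAC !polD exprMn expr1n.
  rewrite exprVn; congr (_ ^+ 2 / _ ^+ 2); last by rewrite sqr2D.
  by rewrite sqr2D expr1n exprMn [(v ^+ e * _) ^+ 2]exprMn.
rewrite tau tv tfv coefE //.
have s1 := v2n1 v1.
(* In characteristic 2 the mixed terms cancel, so both brackets of the condition become squares. *)
have ha1 : (1 + v * fr v) ^+ 2 / (v + fr v) ^+ 2 * v ^+ 2 + 1 =
    (fr v * (1 + v ^+ 2) / (v + fr v)) ^+ 2.
  transitivity (((1 + v * fr v) ^+ 2 * v ^+ 2 + (v + fr v) ^+ 2) / (v + fr v) ^+ 2).
    by field.
  by rewrite expr_div_n; congr (_ / _); ring2.
have ha2 : (1 + v * fr v) ^+ 2 / (v + fr v) ^+ 2 + fr v ^+ 2 =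
    ((1 + fr v ^+ 2) / (v + fr v)) ^+ 2.
  transitivity (((1 + v * fr v) ^+ 2 + (v + fr v) ^+ 2 * fr v ^+ 2) / (v + fr v) ^+ 2).
    by field.
  by rewrite expr_div_n; congr (_ / _); ring2.
have s2 : 1 + v ^+ 2 != 0 by rewrite -(expr1n E 2) -sqr2D expf_neq0.
rewrite ha1 ha2; field.
by rewrite ?d0 ?v0 ?fv0 ?s2.
Qed.

Let mem_absolute a u v : a * fr a = 1 -> u ^+ n1 = 1 -> v ^+ n2 = 1 ->
  (a * u * v \in absolute) =
  ((a ^+ e) ^+ 2 * (a * v ^+ 2 + 1) == v ^+ 2 * (a + fr v ^+ 2)).
Proof.
move=> ha hu hv; rewrite -(wline_factor ha hu hv) inE andb_idl // => _.
have ha' : a ^+ (q + 1) = 1 by rewrite addn1 exprS.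
rewrite cyc_exp -n12 !exprMn (expr_dvd ha') ?dvdn_mull //.
rewrite (expr_dvd hu) ?(expr_dvd hv) ?mulr1 //; last by rewrite -mulnA dvdn_mulr.
by rewrite mulnAC dvdn_mull.
Qed.

Lemma absoluteP x : reflect
  (x ^+ n1 = 1 \/ exists u v,
     [/\ u ^+ n1 = 1, v ^+ n2 = 1, v != 1 & x = coef v * u * v])
  (x \in absolute).
Proof.
apply: (iffP idP) => [xA|[hx|[u [v [hu hv v1 ->]]]]]; last first.
- by rewrite mem_absolute ?coef_unit // coef_factor.
- rewrite -[x]mul1r -[_ * x]mulr1 mem_absolute ?expr1n ?mulr1 //.
have : x \in Cyc by case/setIdP: xA.
rewrite cyc_exp => /eqP /(coprime_root_split copq) [y [a [xE hy ha]]].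
move: hy; rewrite -n12 => /(coprime_root_split cop12) [u [v [yE hu hv]]].
have a1 : a * fr a = 1 by rewrite -exprS -addn1.
move: xA; rewrite xE yE mulrC mulrA mem_absolute // => /eqP cE.
have [a0 aE] := inv_eq a1; have [v0 v2] := inv_eq (unitV hv).
have [v1|v1] := eqVneq v 1.
  (* At v = 1 the condition reads c (a + 1) = a + 1 with c = theta(a)^2. If a were not 1, then c =
     1, and injectivity of theta and of squaring gives a = 1 again. *)
  left; suff -> : a = 1 by rewrite v1 mul1r mulr1.
  move/eqP: cE; rewrite v1 !expr1n mul1r mulr1 -{2}[a + 1]mul1r -subr_eq0 -mulrBl.
  rewrite mulf_eq0 subr_eq0 addr2_eq0 => /orP[|/eqP //].
  by move=> /eqP ae1; apply/pol_inj/sqr2_inj; rewrite /= ae1 !expr1n.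
right; exists u, v; split=> //; congr (_ * _ * _); rewrite coefE //.
have d0 := frob_add_neq0 hv v1.
set c := (a ^+ e) ^+ 2 in cE.
have c0 : c != 0 by rewrite !expf_neq0.
have fc : fr c = c^-1 by rewrite /c -(exprAC a) -exprAC -(exprAC a) aE !exprVn.
have fv0 : fr v != 0 by apply: expf_neq0.
clearbody c.
(* The Frobenius image of the condition, with a and c inverted, gives a second expression for the
   same right side; c then cancels and an equation linear in a remains. *)
have cE' : v ^+ 2 * (a + fr v ^+ 2) = c * (fr v ^+ 2 * (a + v ^+ 2)).
  have fsq (t : E) : fr (t ^+ 2) = fr t ^+ 2 by rewrite exprAC.
  have := congr1 (fun t : E => fr t) cE.
  rewrite /= [fr (c * _)]exprMn [fr (v ^+ 2 * _)]exprMn !frobD [fr (a * _)]exprMn.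
  rewrite !fsq v2 expr1n aE fc => cE2.
  transitivity (c * a * v ^+ 2 * (c^-1 * (a^-1 * fr v ^+ 2 + 1))).
    by field; rewrite a0 c0.
  by rewrite cE2; field; rewrite v0 a0.
move: cE; rewrite {}cE' => /(mulfI c0) cE.
apply: (canRL (mulfK (expf_neq0 2 d0))); rewrite !sqr2D expr1n exprMn.
have : a * v ^+ 2 + 1 + (a * fr v ^+ 2 + v ^+ 2 * fr v ^+ 2) = 0.
  by rewrite cE; ring2.
move=> e0; apply/eqP; rewrite -addr2_eq0; apply/eqP; rewrite -e0; ring.
Qed.

Lemma card_absolute : #|absolute| = (q ^ 2 + 1)%N.
Proof.
(* [coef 1] is 0 in characteristic 2, so the value 1 is put there; the pairs with v = 1 then give
   the roots of order dividing [n1]. *)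
pose g (p : E * E) := (if p.2 == 1 then 1 else coef p.2) * p.1 * p.2.
have n12_gt0 : (0 < n1 * n2)%N by rewrite n12 addn1.
have n1_gt0 : (0 < n1)%N by move: n12_gt0; rewrite muln_gt0 => /andP[].
have n2_gt0 : (0 < n2)%N by move: n12_gt0; rewrite muln_gt0 => /andP[].
have dvdE : (n1 * n2 %| #|E|.-1)%N.
  rewrite n12 cardE; apply/dvdnP; exists (q ^ 2 - 1)%N.
  by rewrite -[(q ^ 4)%N]/(q ^ (2 * 2))%N expnM -subn1 -{3}(exp1n 2) subn_sqr.
have -> : absolute = g @: setX [set u : E | u ^+ n1 == 1] [set v : E | v ^+ n2 == 1].
  apply/setP => x; apply/absoluteP/imsetP => [[hx|[u [v [hu hv v1 ->]]]]|[[u v]]].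
  - by exists (x, 1); rewrite /g ?inE /= ?hx ?expr1n ?eqxx // mul1r mulr1.
  - by exists (u, v); rewrite /g ?inE /= ?hu ?hv ?eqxx // (negPf v1).
  rewrite !inE /g /= => /andP[/eqP hu /eqP hv] ->.
  have [->|v1] := eqVneq v 1; first by left; rewrite mul1r mulr1.
  by right; exists u, v.
rewrite card_in_imset => [|[u v] [u' v']].
  rewrite cardsX !card_unity_roots //; last first.
    exact: dvdn_trans (dvdn_mulr _ (dvdnn _)) dvdE.
  exact: dvdn_trans (dvdn_mull _ (dvdnn _)) dvdE.
rewrite !inE /= => /andP[/eqP hu /eqP hv] /andP[/eqP hu' /eqP hv'] eg.
(* The power q + 1 kills the coefficient. Coprimality of q^2 + 1 and q + 1 then recovers the product
   u v, and coprimality of [n1] and [n2] its factors. *)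
have gE w z : z ^+ n2 = 1 -> g (w, z) ^+ (q + 1) = (w * z) ^+ (q + 1).
  move=> hz; rewrite /g /= -mulrA exprMn addn1 [X in X * _]exprS.
  by have [_|z1] := eqVneq z 1; rewrite ?expr1n ?coef_unit ?mul1r.
have := congr1 (fun t : E => t ^+ (q + 1)) eg; rewrite /= !gE // => euv.
have root_neq0 n (t : E) : (0 < n)%N -> t ^+ n = 1 -> t != 0.
  move=> n0; apply: contra_eq_neq => ->; rewrite expr0n eqn0Ngt n0 /=.
  by rewrite eq_sym oner_neq0.
have u0 := root_neq0 _ _ n1_gt0 hu'; have v0 := root_neq0 _ _ n2_gt0 hv'.
have w0 := root_neq0 _ _ n2_gt0 hv.
have uv1 : u * v / (u' * v') = 1.
  have q0 : (0 < q ^ 2 + 1)%N by rewrite -n12.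
  apply: (coprime_root1 q0 copq).
    rewrite -n12 expr_div_n !exprMn [in v ^+ _]mulnC [in v' ^+ _]mulnC !exprM.
    by rewrite hu hu' hv hv' !expr1n mulr1 divr1.
  rewrite expr_div_n euv divff // expf_neq0 // mulf_neq0 //.
have uE : u / u' = 1.
  apply: (coprime_root1 n1_gt0 cop12); first by rewrite expr_div_n hu hu' divr1.
  have -> : u / u' = (u * v / (u' * v')) * (v' / v).
    by field; rewrite u0 v0 w0.
  by rewrite uv1 mul1r expr_div_n hv hv' divr1.
have vE : v / v' = 1.
  have -> : v / v' = (u * v / (u' * v')) / (u / u').
    by field; rewrite u0 v0 (root_neq0 _ _ n1_gt0 hu).
  by rewrite uv1 uE divr1.
by rewrite -[u](divfK u0) -[v](divfK v0) uE vE !mul1r.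
Qed.

End Polarity.
End CyclicModel.

(** * The two polarities *)

Section SuzukiTits.

Variables (E : finFieldType) (m : nat).
Hypotheses (m3 : (3 <= m)%N) (hodd : odd m) (hE : #|E| = (2 ^ (4 * m))%N).

Local Notation q := (qq m).
(** This is sqrt(q/2), so theta(x) = x^h has theta(x)^2 = x^sqrt(2q). *)
Let h := (2 ^ m./2)%N.

Let char2 : 2%:R = 0 :> E.
Proof. by have := card_finPcharP hE isT; rewrite inE => /andP[_ /eqP]. Qed.

Let exp2D k (x y : E) : (x + y) ^+ (2 ^ k) = x ^+ (2 ^ k) + y ^+ (2 ^ k).
Proof. by apply: exprDn_pchar; rewrite pnatX pnatE // (card_finPcharP hE). Qed.

Let cardE : #|E| = (q ^ 4)%N.
Proof. by rewrite hE /qq -expnM mulnC. Qed.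

Let q2 : (2 < q)%N.
Proof. by rewrite (ltn_exp2l 1 m) // ltnW. Qed.

Let qE : q = (2 * (h * h))%N.
Proof. by rewrite /h -expnD addnn -expnS /qq -[in LHS](odd_double_half m) hodd. Qed.

Let rE : r2q m = (2 * h)%N.
Proof. by rewrite /r2q /= uphalf_half hodd expnS. Qed.

Let h2 : (2 <= h)%N.
Proof. by rewrite -[2%N]expn1 leq_exp2l // half_gt0 ltnW. Qed.

Let r_le_q : (r2q m <= q)%N.
Proof. by rewrite rE qE leq_mul2l leq_pmulr // ltnW. Qed.

Let ss_r : (ss m + r2q m = q + 1)%N.
Proof. by rewrite /ss addnAC subnK. Qed.

Let tt_r : (tt_ m = q + 1 + r2q m)%N.
Proof. by rewrite /tt_ addnAC. Qed.

Let ss_tt : (ss m * tt_ m = q ^ 2 + 1)%N.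
Proof.
rewrite tt_r -ss_r -addnA addnn; apply/eqP.
have := ss_r; rewrite rE qE; move: (ss m) h => s k; clear; nia.
Qed.

Let odd_q1 : odd (q + 1).
Proof. by rewrite addn1 /= qE oddM. Qed.

Let odd_ss : odd (ss m).
Proof. by have := odd_q1; rewrite -ss_r oddD rE oddM addbF. Qed.

(** The difference t - s = 2 sqrt(2q) is a power of two and s is odd. *)
Let cop_st : coprime (ss m) (tt_ m).
Proof.
rewrite tt_r -ss_r -addnA addnn -[(ss m)%N in X in coprime _ X]mul1n.
rewrite /coprime gcdnMDl -/(coprime _ _) rE -mul2n !coprimeMr.
by rewrite !coprimen2 odd_ss coprimeXr ?coprimen2.
Qed.

Let cop_q : coprime (q ^ 2 + 1) (q + 1).
Proof.
have -> : (q ^ 2 + 1 = (q - 1) * (q + 1) + 2)%N.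
  by have := ltnW (ltnW q2); move: (q) => k k0; clear -k0; nia.
by rewrite coprime_sym /coprime gcdnMDl -/(coprime _ _) coprimen2.
Qed.

Let PsetE : Pset E m = Cyc E q.
Proof.
apply/setP => x; rewrite cyc_exp inE; congr (_ ^+ _ == 1).
by clear; rewrite /NP !expnS; lia.
Qed.

(** At beta = b^2 the halved exponents double back to whole ones, the second after reduction by
    b^(N+1) = b. *)
Let mem_Lline (b x : E) : b \in Cyc E q ->
  (x \in Lline E m (b ^+ 2)) = (x \in Cyc E q) && wline q b x.
Proof.
move=> bP; rewrite inE PsetE; congr (_ && _); rewrite /wline /on_line exprS.
have even_q : ~~ odd q by rewrite qE oddM.
have -> : b ^+ 2 ^+ (q ^ 2 + q + 2)./2 = b ^+ 2 * b ^+ q * b ^+ q ^+ q.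
  have o2 : odd (q ^ 2 + q + 2) = false by rewrite !oddD oddX /= (negPf even_q).
  rewrite -exprM mul2n halfK o2 subn0.
  by rewrite -[b ^+ q ^+ q]exprM mulnn -!exprD; congr (_ ^+ _); clear; lia.
have -> : b ^+ 2 ^+ half_qp1 m = b * b ^+ q; last by [].
have oN : odd (NP m).+1 = false.
  by move: even_q; rewrite /NP; move: (q) => k /negPf ek; rewrite oddS !oddD !oddX ek.
rewrite -exprM /half_qp1 mulnCA mul2n halfK oN subn0 mulnC exprM.
suff -> : b ^+ (NP m).+1 = b by rewrite addn1 exprS.
by move: bP; rewrite -PsetE inE exprS => /eqP ->; rewrite mulr1.
Qed.

(** * Transfer to the sets and lines of the statement *)

Section Instance.

Variables e n1 n2 : nat.
Hypotheses (polD : forall x y : E, (x + y) ^+ e = x ^+ e + y ^+ e)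
  (pol2 : forall x : E, (x ^+ e ^+ e) ^+ 2 = x ^+ q)
  (n12 : (n1 * n2 = q ^ 2 + 1)%N) (cop12 : coprime n1 n2)
  (polU : forall u : E, u ^+ n1 = 1 -> (u ^+ e) ^+ 2 = u * u ^+ q)
  (polV : forall v : E, v ^+ n2 = 1 -> (v ^+ e) ^+ 2 * (v * v ^+ q) = 1).

Let absE :
  [set x in Pset E m | x \in Lline E m ((x ^+ e) ^+ 2)] = absolute E q e.
Proof.
apply/setP => x; apply/setIdP/setIdP; rewrite PsetE => -[xP].
  by rewrite mem_Lline ?cyc_pol // => /andP[].
by rewrite mem_Lline ?cyc_pol // xP.
Qed.

Let absolute_ovoid : is_ovoid E m (absolute E q e).
Proof.
have cO : #|absolute E q e| = (q ^ 2 + 1)%N.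
  exact: (card_absolute char2 cardE q2 (exp2D m) polD pol2 n12 cop12 cop_q polU polV).
split=> //; first by rewrite PsetE; apply/subsetP => x /setIdP[].
move=> al be _; have -> : PG_line E m al be = [set x in Cyc E q | on_line q al be x].
  by apply/setP => x; apply/setIdP/setIdP; rewrite PsetE /on_line exprS.
apply: (absolute_line_le2 char2 cardE q2 (exp2D m) polD pol2) => //.
have -> : Cyc E q = [set x : E | x ^+ ((q ^ 2 + 1) * (q + 1)) == 1].
  by apply/setP => x; rewrite inE cyc_exp.
apply: card_unity_roots; first by rewrite !addn1.
rewrite cardE; apply/dvdnP; exists (q - 1)%N.
have := q2; move: (q) => [//|k] _; clear.
by rewrite -subn1 subSS subn0 !expnS expn0; lia.
Qed.

Lemma absolute_points :
  let O := [set x in Pset E m | x \in Lline E m ((x ^+ e) ^+ 2)] in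
  [set u : E | u ^+ n1 == 1] :|:
    [set (v ^+ (q - 1) + v ^- (q - 1)) ^+ (q - 1) * u * v
      | u in [set u : E | u ^+ n1 == 1], v in [set v : E | v ^+ n2 == 1] :\ 1] = O
  /\ is_ovoid E m O.
Proof.
rewrite /= absE; split; last exact: absolute_ovoid.
have absP := absoluteP char2 cardE q2 (exp2D m) polD pol2 n12 cop12 cop_q polU polV.
apply/setP => x; apply/setUP/absP => [[|/imset2P[u v]]|[hx|[u [v [hu hv v1 ->]]]]].
- by rewrite inE => /eqP hx; left.
- rewrite !inE => /eqP hu /andP[v1 /eqP hv] ->; right; by exists u, v.
- by left; rewrite inE hx.
- by right; apply/imset2P; exists u v => //; rewrite !inE ?hu ?hv ?v1 eqxx.
Qed.

End Instance.

Let pow_q4 (x : E) : x ^+ (q ^ 4) = x. Proof. by rewrite -cardE expf_card. Qed.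

Let r_hE (x : E) : (x ^+ h) ^+ 2 = x ^+ r2q m.
Proof. by rewrite -exprM rE mulnC. Qed.

Let rq_hE (x : E) : (x ^+ (q ^ 2 * h)) ^+ 2 = x ^+ (q ^ 2 * r2q m).
Proof. by rewrite -exprM -mulnA rE [(h * 2)%N]mulnC. Qed.

(** Here theta(x) = x^h. Since s + sqrt(2q) = q + 1 and t = q + 1 + sqrt(2q), theta(x)^2 is x^(q+1)
    on O_s and x^(-(q+1)) on O_t. *)
Lemma absolute_points0 : T0 E m = abs_pi0 E m /\ is_ovoid E m (abs_pi0 E m).
Proof.
have -> : abs_pi0 E m = [set x in Pset E m | x \in Lline E m ((x ^+ h) ^+ 2)].
  by apply/setP => x; apply/setIdP/setIdP; rewrite r_hE.
apply: absolute_points => //; first exact: exp2D.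
- by move=> x; rewrite -!exprM qE [(2 * _)%N]mulnC ?mulnA.
- move=> u hu; rewrite r_hE -exprS -addn1 -ss_r exprD.
  by rewrite [u ^+ ss m]hu mul1r.
- by move=> v hv; rewrite r_hE -exprS -exprD -[RHS]hv tt_r -addn1 addnC.
Qed.

(** Here theta(x) = x^(q^2 h). The power q^2 inverts the roots of order dividing q^2 + 1, so O_s and
    O_t exchange their roles. *)
Lemma absolute_points1 : T1 E m = abs_pi1 E m /\ is_ovoid E m (abs_pi1 E m).
Proof.
have -> : abs_pi1 E m = [set x in Pset E m | x \in Lline E m ((x ^+ (q ^ 2 * h)) ^+ 2)].
  by apply/setP => x; apply/setIdP/setIdP; rewrite rq_hE.
have -> : T1 E m = Ot E m :|: [set (v ^+ (q - 1) + v ^- (q - 1)) ^+ (q - 1) * u * v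
      | u in Ot E m, v in Os E m :\ 1].
  congr (_ :|: _); apply/setP => x.
  by apply/imset2P/imset2P => -[u v hu hv ->]; exists v u => //; rewrite mulrAC.
have pow_r (x : E) : x ^+ (ss m * tt_ m) = 1 -> x ^+ (q ^ 2 * r2q m) * x ^+ r2q m = 1.
  by rewrite ss_tt => hx; rewrite -exprD -mulSnr -[(q ^ 2).+1]addn1 exprM hx expr1n.
apply: absolute_points.
- have -> : (q ^ 2 * h = 2 ^ (m * 2 + m./2))%N by rewrite expnD expnM.
  exact: exp2D.
- move=> x; rewrite -!exprM; have -> : (q ^ 2 * h * (q ^ 2 * h * 2) = q ^ 4 * q)%N.
    by rewrite [X in (_ = _ * X)%N]qE; move: (q) (h) => k l; clear; rewrite !expnS; lia.
  by rewrite exprM pow_q4.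
- by rewrite mulnC.
- by rewrite coprime_sym.
- move=> u hu; rewrite rq_hE -exprS; have ur : u ^+ (ss m * tt_ m) = 1.
    by rewrite mulnC exprM hu expr1n.
  have u0 : u ^+ r2q m != 0.
    by apply: contra_eq_neq (pow_r u ur) => ->; rewrite mulr0 eq_sym oner_neq0.
  by apply: (mulIf u0); rewrite pow_r // -exprD -addn1 -tt_r hu.
- move=> v hv; rewrite rq_hE -exprS -[q.+1]addn1 -ss_r exprD hv mul1r pow_r //.
  by rewrite exprM hv expr1n.
Qed.

End SuzukiTits.

Theorem theorem4p3 (E : finFieldType) (m : nat)
    (hm : (3 <= m)%N) (hodd : odd m) (hE : #|E| = (2 ^ (4 * m))%N) :
  [/\ T0 E m = abs_pi0 E m,
      T1 E m = abs_pi1 E m,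
      is_ovoid E m (T0 E m) & is_ovoid E m (T1 E m)].
Proof.
have [T0E O0] := absolute_points0 hm hodd hE.
by have [T1E O1] := absolute_points1 hm hodd hE; rewrite T0E T1E.
Qed.
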